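(* Let $R$ be a domain with field of fractions $K$. Let $I=(f,g)$ be a two-generated fractional ideal of $R$ and let $M$ be a finitely generated rank $n$ $R$-submodule of $K^n$. Then there is an isomorphism of $R$-modules $$\mathrm{T}(I\otimes_R M^* )\cong\frac{(IM)^{-1}}{I^{-1}M^{-1}}.$$ Specifically, $\displaystyle \mathrm{T}(I\otimes_R I^* )\cong\frac{(I^2)^{-1}}{(I^{-1})^2}$.
   Context: Domains are commutative. For an $R$-module $N$, $\mathrm{T}(N)=\{x\in N : rx=0\text{ for some nonzero } r\in R\}$ is its torsion submodule and $N^*=\operatorname{Hom}_R(N,R)$. A fractional ideal of $R$ is a (nonzero) finitely generated $R$-submodule of $K$. For a finitely generated rank $n$ submodule $M$ of $K^n$, the inverse of $M$ is $M^{-1}=\{v\in K^n : v\cdot w\in R\text{ for all }w\in M\}$, where $\cdot$ is the dot product; in particular $I^{-1}=(R:_K I)=\{x\in K: xI\subseteq R\}$. Products such as $IM$ and $I^{-1}M^{-1}$ denote the $R$-submodules of $K^n$ generated by all products of elements. *)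

(* Defs.v *)
From HB Require Import structures.
From mathcomp Require Import all_boot all_algebra.
From mathcomp Require Import boolp classical_sets functions.
From mathcomp.multinomials Require Import freeg.

Set Implicit Arguments.
Unset Strict Implicit.
Unset Printing Implicit Defensive.

Import GRing.Theory.
Local Open Scope classical_set_scope.
Local Open Scope quotient_scope.
Local Open Scope ring_scope.

(* Submodules of V are terms of MathComp's type [submodClosed V] of predicates
   closed under the module operations; [submod S] is S as a module. *)

Section Submodule.
Variables (R : pzRingType) (V : lmodType R).

Definition submod (S : submodClosed V) : Type := {x : V | x \in S}.

HB.instance Definition _ S := SubChoice.on (submod S).
HB.instance Definition _ S := [SubChoice_isSubLmodule of submod S by <:].

(* The submodule generated by A, as the intersection of those containing A. *)
Definition gen_pred (A : set V) : {pred V} :=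
  fun v => `[< forall S : submodClosed V, A `<=` [set` S] -> v \in S >].

Lemma gen_submod_closed A : submod_closed (gen_pred A).
Proof.
split=> [|a u v /asboolP uA /asboolP vA]; apply/asboolP => S AS.
  exact: rpred0.
by rewrite rpredD// ?rpredZ// ?uA ?vA.
Qed.

HB.instance Definition _ A :=
  GRing.isSubmodClosed.Build R V (gen_pred A) (gen_submod_closed A).

Definition gen_submod (A : set V) : submodClosed V := gen_pred A.

Lemma mem_gen A v : A v -> v \in gen_submod A.
Proof. by move=> Av; apply/asboolP => S; apply. Qed.

Lemma gen_min A (S : submodClosed V) :
  (forall v, A v -> v \in S) -> {subset gen_submod A <= S}.
Proof. by move=> AS v /asboolP; apply. Qed.

Lemma gen_ind A (P : V -> Prop) :
    P 0 -> (forall a u v, P u -> P v -> P (a *: u + v)) ->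
  (forall v, A v -> P v) -> forall v, v \in gen_submod A -> P v.
Proof.
move=> P0 PD AP; pose p : {pred V} := fun v => `[< P v >].
have pC : submod_closed p.
  by split=> [|a u v /asboolP Pu /asboolP Pv]; apply/asboolP => //; exact: PD.
pose pM := GRing.isSubmodClosed.Build R V p pC.
pose S : submodClosed V := HB.pack p pM.
by move=> v /(@gen_min A S) vS; apply/asboolP/vS => w Aw; apply/asboolP/AP.
Qed.

Definition fin_gen (S : submodClosed V) : Prop :=
  exists s : seq V, S =i gen_submod [set` s].

End Submodule.

Section Quotient.
Variables (R : pzRingType) (V : lmodType R) (S : submodClosed V).

Definition quo_pred : {pred V} := S.

HB.instance Definition _ :=
  GRing.isZmodClosed.Build V quo_pred
    (GRing.submod_closedB (submodClosedP S)).

Definition quomod : Type := Quotient.quot quo_pred.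

HB.instance Definition _ := GRing.Zmodule.on quomod.

Definition quo_proj (x : V) : quomod := \pi_(Quotient.quot quo_pred) x.

Lemma quo_projP x y : quo_proj x = quo_proj y <-> x - y \in S.
Proof.
by rewrite -[x - y \in S]/(x - y \in quo_pred) Quotient.idealrBE; split=> /eqP.
Qed.

Lemma quo_proj_is_zmod_morphism : zmod_morphism quo_proj.
Proof. by move=> x y; rewrite /quo_proj !piE. Qed.

HB.instance Definition _ :=
  GRing.isZmodMorphism.Build V quomod quo_proj quo_proj_is_zmod_morphism.

Definition quo_repr (q : quomod) : V := repr (q : Quotient.quot quo_pred).

Lemma quo_reprK : cancel quo_repr quo_proj.
Proof. by move=> q; rewrite /quo_proj /quo_repr reprK. Qed.

Definition quo_scale (a : R) (q : quomod) : quomod := quo_proj (a *: quo_repr q).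

Lemma quo_scale_proj a x : quo_scale a (quo_proj x) = quo_proj (a *: x).
Proof.
by apply/quo_projP; rewrite -scalerBr rpredZ//; apply/quo_projP/quo_reprK.
Qed.

Lemma quo_scaleA a b q : quo_scale a (quo_scale b q) = quo_scale (a * b) q.
Proof. by rewrite -(quo_reprK q) !quo_scale_proj scalerA. Qed.

Lemma quo_scale1 : left_id 1 quo_scale.
Proof. by move=> q; rewrite -(quo_reprK q) quo_scale_proj scale1r. Qed.

Lemma quo_scaleDr : right_distributive quo_scale +%R.
Proof.
move=> a p q; rewrite -(quo_reprK p) -(quo_reprK q) -raddfD !quo_scale_proj.
by rewrite scalerDr raddfD.
Qed.

Lemma quo_scaleDl q : {morph quo_scale^~ q : a b / a + b}.
Proof.
by move=> a b; rewrite -(quo_reprK q) !quo_scale_proj scalerDl raddfD.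
Qed.

HB.instance Definition _ := GRing.Zmodule_isLmodule.Build R quomod
  quo_scaleA quo_scale1 quo_scaleDr quo_scaleDl.

Lemma quo_proj_is_scalable : scalable quo_proj.
Proof. by move=> a x; rewrite -quo_scale_proj. Qed.

HB.instance Definition _ :=
  GRing.isScalable.Build R V quomod *:%R quo_proj quo_proj_is_scalable.

End Quotient.

Section SubQuotient.
Variables (R : pzRingType) (V : lmodType R) (P N : submodClosed V).

Definition sub_in_pred : {pred submod P} := fun x => val x \in N.

Lemma sub_in_submod_closed : submod_closed sub_in_pred.
Proof.
split=> [|a u v uN vN]; first exact: rpred0.
by apply: rpredD; [exact: rpredZ|].
Qed.

HB.instance Definition _ := GRing.isSubmodClosed.Build R (submod P)
  sub_in_pred sub_in_submod_closed.

(* P / N, for N contained in P; see [prod_colon_colon] and [prod_colon_dotinv]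
   for the inclusions relevant here. *)
Definition subquo := quomod (sub_in_pred : submodClosed (submod P)).

End SubQuotient.

Definition isomorphic (R : pzRingType) (U V : lmodType R) : Prop :=
  exists phi : {linear U -> V}, bijective phi.

Section Dual.
Variables (R : comPzRingType) (N : lmodType R).

Definition linear_pred : {pred N -> R^o} := fun h => `[< linear h >].

Lemma linear_submod_closed : submod_closed linear_pred.
Proof.
split=> [|a h k /asboolP hl /asboolP kl]; apply/asboolP => b x y.
  by rewrite /= scaler0 addr0.
rewrite !fctE hl kl; set t := h x; set u := k x.
by rewrite !scalerDr !scalerA (mulrC a b) addrACA.
Qed.

HB.instance Definition _ := GRing.isSubmodClosed.Build R (N -> R^o)
  linear_pred linear_submod_closed.

(* Hom_R(N, R) with its pointwise module structure. *)
Definition dualmod := submod (linear_pred : submodClosed (N -> R^o)).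

End Dual.

Section Torsion.
Variables (R : idomainType) (N : lmodType R).

Definition torsion_pred : {pred N} :=
  fun x => `[< exists2 r : R, r != 0 & r *: x = 0 >].

Lemma torsion_submod_closed : submod_closed torsion_pred.
Proof.
split=> [|a u v /asboolP[r r0 ru] /asboolP[s s0 sv]]; apply/asboolP.
  by exists 1; rewrite ?oner_neq0// scaler0.
exists (r * s); first by rewrite mulf_neq0.
rewrite scalerDr -[in X in _ + X]scalerA sv scaler0 addr0.
by rewrite scalerA mulrAC -mulrA mulrC -scalerA mulrC -scalerA ru !scaler0.
Qed.

HB.instance Definition _ := GRing.isSubmodClosed.Build R N
  torsion_pred torsion_submod_closed.

Definition torsion := submod (torsion_pred : submodClosed N).

End Torsion.

Section Rank.
Variables (R : idomainType) (N : lmodType R).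

Definition lin_indep k (b : 'I_k -> N) : Prop :=
  forall c : 'I_k -> R, \sum_(i < k) c i *: b i = 0 -> forall i, c i = 0.

(* N has rank k when k is the largest size of an R-linearly independent family
   in N, that is, when K (x)_R N has dimension k over K = Frac R. *)
Definition has_rank (k : nat) : Prop :=
  (exists b : 'I_k -> N, lin_indep b) /\
  forall b : 'I_k.+1 -> N, ~ lin_indep b.

End Rank.

(* The tensor product is the free module on U * V modulo the bilinearity
   relations; [tensorP] is its universal property. *)

Section Tensor.
Variables (R : comNzRingType) (U V : lmodType R).

Definition tensor_rel : set {freeg (U * V)%type / R} :=
  [set z | [\/ exists u u' v,
                 z = << (u + u', v) >> - << (u, v) >> - << (u', v) >>,
               exists u v v',
                 z = << (u, v + v') >> - << (u, v) >> - << (u, v') >>,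
               exists a u v, z = << (a *: u, v) >> - a *: << (u, v) >>
             | exists a u v, z = << (u, a *: v) >> - a *: << (u, v) >> ] ].

Definition tensor := quomod (gen_submod tensor_rel).

Definition tens (u : U) (v : V) : tensor :=
  quo_proj (gen_submod tensor_rel) << (u, v) >>.

Lemma tensDl u u' v : tens (u + u') v = tens u v + tens u' v.
Proof.
rewrite /tens -raddfD; apply/quo_projP/mem_gen; apply: Or41.
by exists u, u', v; rewrite opprD addrA.
Qed.

Lemma tensDr u v v' : tens u (v + v') = tens u v + tens u v'.
Proof.
rewrite /tens -raddfD; apply/quo_projP/mem_gen; apply: Or42.
by exists u, v, v'; rewrite opprD addrA.
Qed.

Lemma tensZl a u v : tens (a *: u) v = a *: tens u v.
Proof.
rewrite /tens -linearZ; apply/quo_projP/mem_gen; apply: Or43.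
by exists a, u, v.
Qed.

Lemma tensZr a u v : tens u (a *: v) = a *: tens u v.
Proof.
rewrite /tens -linearZ; apply/quo_projP/mem_gen; apply: Or44.
by exists a, u, v.
Qed.

Section Universal.
Variables (W : lmodType R) (beta : U -> V -> W).
Hypotheses (betaDl : forall u u' v, beta (u + u') v = beta u v + beta u' v)
  (betaDr : forall u v v', beta u (v + v') = beta u v + beta u v')
  (betaZl : forall a u v, beta (a *: u) v = a *: beta u v)
  (betaZr : forall a u v, beta u (a *: v) = a *: beta u v).

Let lift (z : {freeg (U * V)%type / R}) : W :=
  fglift (fun p : U * V => beta p.1 p.2) z.

Let liftB : {morph lift : x y / x - y}.
Proof. exact: lift_is_additive. Qed.

Let lift0 : lift 0 = 0.
Proof. by rewrite -[0 in LHS](subrr 0) liftB subrr. Qed.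

Let liftD : {morph lift : x y / x + y}.
Proof.
move=> x y; rewrite -[y in LHS]opprK -[- y in LHS]sub0r.
by rewrite !liftB lift0 sub0r opprK.
Qed.

Let lift1 u v : lift << (u, v) >> = beta u v.
Proof. by rewrite /lift liftU scale1r. Qed.

Let liftZ a x : lift (a *: x) = a *: lift x.
Proof.
rewrite -[x]freeg_sumE scaler_sumr.
rewrite !(big_morph lift liftD lift0) scaler_sumr; apply: eq_bigr => p _.
have -> : a *: << coeff p x *g p >> = << a * coeff p x *g p >>.
  by apply/eqP/freeg_eqP => k; rewrite coeffZ !coeffU mulrA.
by rewrite /lift !liftU scalerA.
Qed.

Let lift_rel z : z \in gen_submod tensor_rel -> lift z = 0.
Proof.
move: z; apply: gen_ind => [|a x y x0 y0|z].
- exact: lift0.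
- by rewrite liftD liftZ x0 y0 scaler0 addr0.
case=> [[u [u' [v ->]]]|[u [v [v' ->]]]|[a [u [v ->]]]|[a [u [v ->]]]];
  rewrite !liftB ?liftZ !lift1.
- by rewrite betaDl addrAC addrK subrr.
- by rewrite betaDr addrAC addrK subrr.
- by rewrite betaZl subrr.
- by rewrite betaZr subrr.
Qed.

Let ext (q : tensor) : W := lift (quo_repr q).

Let ext_proj z : ext (quo_proj _ z) = lift z.
Proof.
apply/eqP; rewrite -subr_eq0 -liftB; apply/eqP/lift_rel.
exact/quo_projP/quo_reprK.
Qed.

Let ext_linear : linear ext.
Proof.
move=> a p q; rewrite -(quo_reprK p) -(quo_reprK q) -linearP !ext_proj.
by rewrite liftD liftZ.
Qed.

Lemma tensorP : exists phi : {linear tensor -> W},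
  (forall u v, phi (tens u v) = beta u v) /\
  forall psi : {linear tensor -> W},
    (forall u v, psi (tens u v) = beta u v) -> psi =1 phi.
Proof.
pose extL := GRing.isLinear.Build R tensor W *:%R ext ext_linear.
pose phi : {linear tensor -> W} := HB.pack ext extL.
have phiE z : phi (quo_proj _ z) = lift z by exact: ext_proj.
exists phi; split=> [u v|psi psiE q]; first by rewrite phiE lift1.
rewrite -(quo_reprK q); move: (quo_repr q) => z.
rewrite -[z]freeg_sumE !linear_sum; apply: eq_bigr => -[u v] _.
have -> : << coeff (u, v) z *g (u, v) >> =
    coeff (u, v) z *: << (u, v) >> :> {freeg (U * V)%type / R}.
  by apply/eqP/freeg_eqP => k; rewrite coeffZ !coeffU mul1r.
by rewrite !linearZ -/(tens u v) psiE; congr (_ *: _); rewrite phiE lift1.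
Qed.

End Universal.

End Tensor.

Section Scalars.
Variables (R : idomainType) (V : lmodType {fraction R}).

(* V viewed as an R-module by restriction of scalars to R. *)
Definition res_scal : Type := V.

HB.instance Definition _ := GRing.Zmodule.on res_scal.

Definition res_scale (r : R) (v : res_scal) : res_scal :=
  (tofrac r *: (v : V))%R.

Lemma res_scaleA a b v : res_scale a (res_scale b v) = res_scale (a * b) v.
Proof. by rewrite /res_scale scalerA rmorphM. Qed.

Lemma res_scale1 : left_id 1 res_scale.
Proof. by move=> v; rewrite /res_scale rmorph1 scale1r. Qed.

Lemma res_scaleDr : right_distributive res_scale +%R.
Proof. by move=> a u v; exact: scalerDr. Qed.

Lemma res_scaleDl v : {morph res_scale^~ v : a b / a + b}.
Proof. by move=> a b; rewrite /res_scale rmorphD; exact: scalerDl. Qed.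

HB.instance Definition _ := GRing.Zmodule_isLmodule.Build R res_scal
  res_scaleA res_scale1 res_scaleDr res_scaleDl.

End Scalars.

Section Fractional.
Variable R : idomainType.
Local Notation K := {fraction R}.

Definition fractional_ideal (I : submodClosed (res_scal K^o)) : Prop :=
  fin_gen I /\ exists2 x, x \in I & x != 0.

(* The R-submodule generated by the products a v, a in I and v in M; for V = K
   it is the product of submodules of K. *)
Definition prodmod (V : lmodType K) (I : submodClosed (res_scal K^o))
    (M : submodClosed (res_scal V)) : submodClosed (res_scal V) :=
  gen_submod [set w : res_scal V | exists (a : K) (v : V),
    [/\ a \in I, v \in M & w = a *: v]].

Definition in_base (x : K) : Prop := exists r : R, x = tofrac r.

Definition colon_pred (I : submodClosed (res_scal K^o)) :
    {pred res_scal K^o} :=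
  fun x => `[< forall y : K, y \in I -> in_base ((x : K) * y) >].

Lemma colon_submod_closed I : submod_closed (colon_pred I).
Proof.
split=> [|a u v /asboolP uI /asboolP vI]; apply/asboolP => y yI.
  by exists 0; rewrite mul0r rmorph0.
have [[r ur] [s vs]] := (uI _ yI, vI _ yI).
exists (a * r + s).
rewrite tofracD tofracM -ur -vs (mulrA (tofrac a)).
exact: mulrDl (tofrac a * u : K) v y.
Qed.

HB.instance Definition _ I := GRing.isSubmodClosed.Build R (res_scal K^o)
  (colon_pred I) (colon_submod_closed I).

(* I^-1 = (R :_K I) *)
Definition colon I : submodClosed (res_scal K^o) := colon_pred I.

Definition dot n (v w : 'rV[K]_n) : K := \sum_(i < n) v 0 i * w 0 i.

Definition dotinv_pred n (M : submodClosed (res_scal 'rV[K]_n)) :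
    {pred res_scal 'rV[K]_n} :=
  fun v => `[< forall w : 'rV[K]_n, w \in M -> in_base (dot v w) >].

Lemma dotinv_submod_closed n M : submod_closed (@dotinv_pred n M).
Proof.
split=> [|a u v /asboolP uM /asboolP vM]; apply/asboolP => w wM.
  by exists 0; rewrite rmorph0 /dot big1// => i _; rewrite mxE mul0r.
have [[r ur] [s vs]] := (uM _ wM, vM _ wM); exists (a * r + s).
rewrite tofracD tofracM -ur -vs /dot mulr_sumr -big_split/=.
by apply: eq_bigr => i _; rewrite !mxE mulrDl mulrA.
Qed.

HB.instance Definition _ n M :=
  GRing.isSubmodClosed.Build R (res_scal 'rV[K]_n)
    (@dotinv_pred n M) (dotinv_submod_closed M).

(* M^-1, the inverse of a submodule of K^n for the dot product *)
Definition dotinv n M : submodClosed (res_scal 'rV[K]_n) := @dotinv_pred n M.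

Lemma in_baseDM (r : R) (x y : K) :
  in_base x -> in_base y -> in_base (tofrac r * x + y).
Proof.
by move=> [p ->] [q ->]; exists (r * p + q); rewrite tofracD tofracM.
Qed.

Lemma prod_colon_colon I J :
  {subset prodmod (colon I) (colon J) <= colon (prodmod I J)}.
Proof.
apply: gen_min => _ [a [v [/asboolP aI /asboolP vJ ->]]].
apply/asboolP.
apply: (gen_ind (P := fun y : res_scal K^o => in_base ((a *: v : K) * y))).
- by exists 0; rewrite mulr0 tofrac0.
- move=> r s t sP tP; have -> : (a *: v : K) * (r *: s + t : res_scal K^o) =
      tofrac r * ((a * v) * s) + (a * v) * t :> K.
    by rewrite mulrCA; exact: mulrDr (a * v) (tofrac r * s : K) (t : K).
  exact: in_baseDM.
move=> _ [b [w [bI wJ ->]]]; have [[p bp] [q wq]] := (aI _ bI, vJ _ wJ).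
by exists (p * q); rewrite tofracM -bp -wq mulrACA.
Qed.

Lemma prod_colon_dotinv n I (M : submodClosed (res_scal 'rV[K]_n)) :
  {subset prodmod (colon I) (dotinv M) <= dotinv (prodmod I M)}.
Proof.
apply: gen_min => _ [a [v [/asboolP aI /asboolP vM ->]]].
apply/asboolP.
apply: (gen_ind
  (P := fun w : res_scal 'rV[K]_n => in_base (dot (a *: v) w))).
- by exists 0; rewrite tofrac0 /dot big1// => i _; rewrite [X in _ * X]mxE mulr0.
- move=> r s t sP tP; have -> : dot (a *: v) (r *: s + t : res_scal 'rV[K]_n) =
      tofrac r * dot (a *: v) s + dot (a *: v) t.
    rewrite /dot mulr_sumr -big_split/=; apply: eq_bigr => i _.
    by rewrite !mxE mulrDr mulrCA.
  exact: in_baseDM.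
move=> _ [b [w [bI wM ->]]]; have [[p bp] [q wq]] := (aI _ bI, vM _ wM).
exists (p * q); rewrite tofracM -bp -wq /dot mulr_sumr.
by apply: eq_bigr => i _; rewrite !mxE mulrACA.
Qed.

End Fractional.

(* Main.v *)
From HB Require Import structures.
Require Import Defs.
From mathcomp Require Import all_boot all_algebra.
From mathcomp Require Import classical_sets boolp ring.
From mathcomp.multinomials Require Import freeg.

(** The reason behind the isomorphism is that a two-generated ideal has a
    single kind of syzygy.  Let N be M^-1, which is a copy of M^*: every
    functional on M extends to K^n and is the dot product with a unique vector.
    If r f + s g = 0 and (f, g) is nonzero, then (r, s) = (g t, - f t) for a
    unique t in I^-1.  Hence f (x) x + g (x) y = 0 in I (x) N exactly when
    (x, y) = (g z, - f z) with z in I^-1 N.  On the other hand, torsion elements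
    of I (x) N are those killed by the map to K^n, so f (x) x + g (x) y is
    torsion exactly when f x + g y = 0, that is, (x, y) = (g z, - f z) with
    z in K^n.  The vectors z that occur are those with f z and g z in N, and they
    form (I M)^-1.  So

      psi : (I M)^-1 -> I (x) N,   z |-> f (x) g z - g (x) f z

    has the torsion submodule as image and I^-1 N as kernel.

    The kernel is computed without presenting I (x) N by generators and
    relations: if f is nonzero, then (r f + s g) (x) v |-> - (s / f) v is a
    well-defined map phi from I (x) N to K^n / I^-1 N, because s / f lies in I^-1
    whenever r f + s g = 0 ([syzygy_colon]), and phi (psi z) is the class of z.

    This argument, [torsion_tensor_embedded], applies to any module D embedded in
    a K-vector space V in place of M^*.  The embedding of M^* as M^-1 is obtained
    in [dual_embedding] for any nondegenerate pairing on V that represents all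
    functionals on M.  The two parts of the theorem are the dot product on K^n
    and the multiplication of K. *)

Set Implicit Arguments.
Unset Strict Implicit.
Unset Printing Implicit Defensive.
Import GRing.Theory.
Local Open Scope classical_set_scope.
Local Open Scope quotient_scope.
Local Open Scope ring_scope.

(** * Modules, quotients and tensor products *)

(** The first isomorphism theorem, in the direction from the image to the
    quotient: the inverse of the map induced by [psi] sends [y] to the class of
    any preimage. *)
Lemma image_isomorphic_subquo (R : pzRingType) (V W : lmodType R)
    (P N : submodClosed V) (S : submodClosed W) (psi : {linear submod P -> W}) :
    (forall x, psi x = 0 <-> val x \in N) -> (forall x, psi x \in S) ->
    (forall y, y \in S -> exists x, psi x = y) ->
  isomorphic (submod S) (subquo P N).
Proof.
move=> psi_ker psiS psi_surj.
have /choice[pre preK] (y : submod S) : exists x, psi x = val y.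
  exact/psi_surj/valP.
pose phi (y : submod S) : subquo P N := quo_proj _ (pre y).
have phiE x y : psi x = val y -> phi y = quo_proj _ x.
  by move=> xy; apply/quo_projP/psi_ker; rewrite raddfB/= preK xy subrr.
have phi_linear : linear phi.
  move=> a y z; rewrite -linearP; apply: phiE.
  by rewrite [LHS]linearP !preK [RHS]linearP.
pose phiL := GRing.isLinear.Build R (submod S) (subquo P N) *:%R phi phi_linear.
pose Phi : {linear submod S -> subquo P N} := HB.pack phi phiL.
exists Phi; exists (fun q => Sub (psi (quo_repr q)) (psiS _)) => [y|q].
  apply/val_inj; rewrite SubK -[RHS]preK; apply/eqP; rewrite -subr_eq0 -raddfB.
  apply/eqP/psi_ker/(quo_projP (sub_in_pred (P := P) N : submodClosed _)).
  by rewrite quo_reprK.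
by rewrite -[RHS]quo_reprK; apply: phiE; rewrite SubK.
Qed.

Lemma tensor_two_gen (R : comNzRingType) (U W : lmodType R) (u v : U) :
    (forall x, exists r s, x = r *: u + s *: v) ->
  forall q : tensor U W, exists x y, q = tens u x + tens v y.
Proof.
move=> uv q; rewrite -(quo_reprK q) -[quo_repr q]freeg_sumE raddf_sum/=.
apply: (big_ind (fun q => exists x y, q = tens u x + tens v y)).
- exists 0, 0; apply/esym; rewrite -[0 in LHS](scale0r 0).
  by rewrite !tensZr !scale0r addr0.
- move=> _ _ [x [y ->]] [x' [y' ->]]; exists (x + x'), (y + y').
  by rewrite !tensDr addrACA.
move=> [x w] _; set c := coeff _ _.
have -> : << c *g (x, w) >> = c *: << (x, w) >> :> {freeg (U * W)%type / R}.
  by apply/eqP/freeg_eqP => k; rewrite coeffZ !coeffU mul1r.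
rewrite linearZ/= -/(tens x w); have [r [s ->]] := uv x.
exists ((c * r) *: w), ((c * s) *: w).
by rewrite tensDl !tensZl !tensZr scalerDr !scalerA.
Qed.

Lemma val_lincomb (R : pzRingType) (V : lmodType R) (S : submodClosed V)
    (r s : R) (u v : submod S) :
  val (r *: u + s *: v) = r *: val u + s *: val v.
Proof. by rewrite linearD !linearZ. Qed.

Lemma dualE (R : comNzRingType) (N : lmodType R) (a : R) (h k : dualmod N)
    (w : N) :
  (val (a *: h + k) : N -> R) w = a * (val h : N -> R) w + (val k : N -> R) w.
Proof.
exact: (congr1 (fun F : N -> R^o => F w) (linearP val a h k)).
Qed.

(** * Fractions and restriction of scalars *)

Section Denominators.
Variable R : idomainType.
Local Notation K := {fraction R}.

Lemma frac_denom (x : K) : exists2 r : R, r != 0 & in_base (tofrac r * x).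
Proof.
elim/quotW: x => q; exists q.2; first exact: denom_ratioP.
exists q.1; unlock tofrac; rewrite -[LHS]FracField.pi_mul.
apply/eqmodP; rewrite /= FracField.equivfE /FracField.mulf.
rewrite !numden_Ratio ?mulf_neq0 ?oner_neq0 ?denom_ratioP//.
by rewrite !mulr1 mul1r mulrC.
Qed.

Lemma fin_denom k (c : 'I_k -> K) :
  exists2 r : R, r != 0 & forall i, in_base (tofrac r * c i).
Proof.
have /choice[d dP] i : exists r : R, r != 0 /\ in_base (tofrac r * c i).
  by have [r] := frac_denom (c i); exists r.
exists (\prod_i d i) => [|i]; first by apply/prodf_neq0 => i _; case: (dP i).
have [_ [a da]] := dP i; exists ((\prod_(j | j != i) d j) * a).
by rewrite (bigD1 i)//= !tofracM -da mulrAC mulrA mulrC mulrA mulrC.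
Qed.

End Denominators.

(* A K-vector space and its restriction of scalars share their carrier but not
   their scaling; the next lemmas pass from one to the other. *)
Lemma res_scaleE (R : idomainType) (V : lmodType {fraction R}) (r : R) (v : V) :
  r *: (v : res_scal V) = tofrac r *: v.
Proof. by []. Qed.

Lemma val_linearK (R : idomainType) (V : lmodType {fraction R})
    (M : submodClosed (res_scal V)) (r : R) (u v : submod M) :
  val (r *: u + v) = tofrac r *: (val u : V) + (val v : V) :> V.
Proof. by rewrite [LHS]linearP. Qed.

Lemma val_lincombK (R : idomainType) (I : submodClosed (res_scal {fraction R}^o))
    (r s : R) (u v : submod I) :
  val (r *: u + s *: v) = tofrac r * val u + tofrac s * val v :> {fraction R}.
Proof. by rewrite [LHS]val_lincomb. Qed.

Lemma val_scaleK (R : idomainType) (I : submodClosed (res_scal {fraction R}^o))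
    (r : R) (u : submod I) :
  val (r *: u) = tofrac r * val u :> {fraction R}.
Proof. by rewrite [LHS]linearZ. Qed.

Lemma torsion_free_res_scal (R : idomainType) (V : lmodType {fraction R}) (r : R)
    (v : res_scal V) : r != 0 -> r *: v = 0 -> v = 0.
Proof.
move=> r0 /(congr1 (fun w : V => (tofrac r)^-1 *: w)).
by rewrite [r *: v]res_scaleE scalerA mulVf ?tofrac_eq0// scale1r scaler0.
Qed.

Lemma mem_prod (R : idomainType) (V : lmodType {fraction R})
    (I : submodClosed (res_scal {fraction R}^o)) (M : submodClosed (res_scal V))
    (a : {fraction R}) (v : V) :
  (a : res_scal {fraction R}^o) \in I -> (v : res_scal V) \in M ->
  (a *: v : res_scal V) \in prodmod I M.
Proof. by move=> aI vM; apply: mem_gen; exists a, v; split. Qed.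

(** * Two-generated ideals *)

(** The syzygy (r, s) is (g t, - f t) for t = - s / f, and multiplication by t
    therefore maps r' f + s' g into the ring generated by the coefficients. *)
Lemma syzygy_mul (F : fieldType) (f g r s r' s' : F) :
  f != 0 -> r * f + s * g = 0 -> s / f * (r' * f + s' * g) = s * r' - r * s'.
Proof.
move=> f0 /eqP; rewrite addr_eq0 => /eqP rs.
by apply: (mulIf f0); rewrite [LHS]mulrAC mulfVK// mulrBl (mulrAC r) rs; ring.
Qed.

Section TwoGenerated.
Variables (R : idomainType) (f g : {fraction R}).
Variable I : submodClosed (res_scal {fraction R}^o).
Local Notation K := {fraction R}.
Hypothesis I_gen : I =i gen_submod ([set f; g] : set (res_scal K^o)).

Lemma mem_gen1 : (f : res_scal K^o) \in I.
Proof. by rewrite I_gen; apply: mem_gen; left. Qed.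

Lemma mem_gen2 : (g : res_scal K^o) \in I.
Proof. by rewrite I_gen; apply: mem_gen; right. Qed.

Lemma two_gen_coord (x : K) : x \in I ->
  exists r s : R, x = tofrac r * f + tofrac s * g.
Proof.
rewrite I_gen; apply: (gen_ind (P := fun x : res_scal K^o =>
  exists r s : R, x = tofrac r * f + tofrac s * g :> K)) =>
    [|a u v [r [s ->]] [r' [s' ->]]|_ [->|->]].
- by exists 0, 0; rewrite tofrac0 !mul0r addr0.
- exists (a * r + r'), (a * s + s'); rewrite !tofracD !tofracM.
  change (tofrac a * (tofrac r * f + tofrac s * g) +
      (tofrac r' * f + tofrac s' * g) =
    (tofrac a * tofrac r + tofrac r') * f +
      (tofrac a * tofrac s + tofrac s') * g).
  by ring.
- by exists 1, 0; rewrite tofrac0 tofrac1 mul1r mul0r addr0.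
by exists 0, 1; rewrite tofrac0 tofrac1 mul1r mul0r add0r.
Qed.

Section Embedded.
Variables (V : lmodType K) (D : lmodType R) (iota : {linear D -> res_scal V}).
(* N is the copy of D inside V, and P is the colon module (N : I). *)
Variables (N P : submodClosed (res_scal V)).
Hypothesis f_neq0 : f != 0.
Hypothesis iota_inj : injective iota.
Hypothesis mem_N : forall v, v \in N <-> exists d, iota d = v.
Hypothesis mem_P : forall z : V, z \in P <-> f *: z \in N /\ g *: z \in N.

Let U := submod I.
Let uf : U := exist _ (f : res_scal K^o) mem_gen1.
Let ug : U := exist _ (g : res_scal K^o) mem_gen2.
Let valU (r s : R) :
  (val (r *: uf + s *: ug) : K) = tofrac r * f + tofrac s * g.
Proof. exact: val_lincombK. Qed.

Let U_coord (u : U) : exists r s : R, u = r *: uf + s *: ug.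
Proof.
have [r [s rs]] := two_gen_coord (valP u); exists r, s.
by apply/val_inj; rewrite valU.
Qed.

(** Dividing a syzygy by f turns it into an element of I^-1; this is where the
    number of generators of I matters. *)
Lemma syzygy_colon (r s : R) :
  tofrac r * f + tofrac s * g = 0 -> (tofrac s / f : K) \in colon I.
Proof.
move=> rs; apply/asboolP => y /two_gen_coord[r' [s' ->]].
exists (s * r' - r * s'); rewrite tofracB !tofracM.
exact: syzygy_mul.
Qed.

Let coef (u : U) : exists s : R, exists r, u = r *: uf + s *: ug.
Proof. by have [r [s ->]] := U_coord u; exists s, r. Qed.

(* The coefficient of g is not determined by u, so one is chosen; [betaE] shows
   that modulo I^-1 N the choice is immaterial. *)
Let s_ u : R := projT1 (cid (coef u)).
Let Q := quomod (prodmod (colon I) N).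
Let proj (v : V) : Q := quo_proj (prodmod (colon I) N) v.
Let beta (u : U) (d : D) : Q := proj ((- (tofrac (s_ u) / f)) *: (iota d : V)).

Let betaE r s d :
  beta (r *: uf + s *: ug) d = proj ((- (tofrac s / f)) *: (iota d : V)).
Proof.
rewrite /beta /s_; case: cid => s' [/= r' E].
apply/quo_projP; have -> : (- (tofrac s' / f)) *: (iota d : V) -
   (- (tofrac s / f)) *: (iota d : V) = (tofrac (s - s') / f) *: (iota d : V).
  by rewrite -scalerBl tofracB; congr (_ *: _); ring.
apply: mem_prod; last by apply/mem_N; exists d.
apply: (@syzygy_colon (r - r')).
have /(congr1 (fun u : U => val u : K)) := E; rewrite !valU => E'.
by rewrite !tofracB !mulrBl addrACA E' -opprD subrr.
Qed.

(** This map is a left inverse of psi modulo I^-1 N, so it detects the kernel of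
    psi. *)
Let retraction : exists phi : {linear tensor U D -> Q},
  forall r s d, phi (tens (r *: uf + s *: ug) d) =
    proj ((- (tofrac s / f)) *: (iota d : V)).
Proof.
have projD v w : proj (v + w) = proj v + proj w by exact: raddfD.
have projZ a v : proj (tofrac a *: v) = a *: proj v.
  exact: (quo_proj_is_scalable (prodmod (colon I) N) a v).
have [||||phi [phiE _]] := @tensorP R U D Q beta.
- move=> u u' d; have [r [s ->]] := U_coord u; have [r' [s' ->]] := U_coord u'.
  rewrite addrACA -!scalerDl !betaE -projD -scalerDl tofracD.
  by congr (proj (_ *: _)); ring.
- by move=> u d d'; rewrite /beta raddfD/= -projD -scalerDr.
- move=> a u d; have [r [s ->]] := U_coord u.
  rewrite scalerDr !scalerA !betaE -projZ scalerA tofracM.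
  by congr (proj (_ *: _)); ring.
- move=> a u d; rewrite /beta linearZ/= -projZ; congr proj.
  change (- (tofrac (s_ u) / f) *: (tofrac a *: (iota d : V)) =
    tofrac a *: (- (tofrac (s_ u) / f) *: (iota d : V))).
  by rewrite !scalerA mulrC.
by exists phi => r s d; rewrite phiE betaE.
Qed.

(** V is torsion-free over R, so this multiplication map kills torsion: it turns
    being torsion into the equation f x + g y = 0 in V. *)
Let evaluation : exists eta : {linear tensor U D -> res_scal V},
  forall u d, eta (tens u d) = (val u : K) *: (iota d : V).
Proof.
have [||||eta [etaE _]] :=
  @tensorP R U D (res_scal V) (fun u d => (val u : K) *: (iota d : V)).
- by move=> u u' d; rewrite raddfD/= [in LHS]scalerDl.
- by move=> u d d'; rewrite raddfD/= [in LHS]scalerDr.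
- by move=> a u d; rewrite [RHS]res_scaleE scalerA val_scaleK.
- by move=> a u d; rewrite linearZ/= !res_scaleE !scalerA mulrC.
by exists eta.
Qed.

(** The torsion of I (x) D is the image of z |-> f (x) g z - g (x) f z on (N : I),
    where f z and g z stand for their preimages in D. *)
Lemma torsion_tensor_embedded :
  isomorphic (torsion (tensor U D)) (subquo P (prodmod (colon I) N)).
Proof.
have [phi phiE] := retraction.
have /choice[j jK] (v : V) : exists d, v \in N -> iota d = v.
  by have [/mem_N[d <-]|] := boolP (v \in N); [exists d|exists 0].
have jE v d : iota d = v -> j v = d.
  by move=> dv; apply: iota_inj; rewrite jK//; apply/mem_N; exists d.
pose psi (z : submod P) : tensor U D :=
  tens uf (j (g *: (val z : V))) - tens ug (j (f *: (val z : V))).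
(* [j] is additive only on N, and P need not lie in N: hence the factor c. *)
have jlin (c : K) (a : R) (y z : submod P) :
    (forall x : submod P, c *: (val x : V) \in N) ->
  j (c *: (val (a *: y + z) : V)) =
    a *: j (c *: (val y : V)) + j (c *: (val z : V)).
  move=> cN; apply: jE; rewrite linearP !jK//.
  change (tofrac a *: (c *: (val y : V)) + c *: (val z : V) =
    c *: (tofrac a *: (val y : V) + val z)).
  by rewrite scalerDr !scalerA mulrC.
have fN (x : submod P) : f *: (val x : V) \in N by have /mem_P[] := valP x.
have gN (x : submod P) : g *: (val x : V) \in N by have /mem_P[] := valP x.
have psi_linear : linear psi.
  move=> a y z; rewrite /psi !jlin// !tensDr !tensZr scalerBr opprD.
  by rewrite addrACA.
pose psiL := GRing.isLinear.Build R (submod P) (tensor U D) *:%R psi psi_linear.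
pose Psi : {linear submod P -> tensor U D} := HB.pack psi psiL.
have phi_f d : phi (tens uf d) = proj 0.
  rewrite [uf](_ : _ = 1 *: uf + 0 *: ug); last by rewrite scale1r scale0r addr0.
  by rewrite phiE tofrac0 mul0r oppr0 scale0r.
have phi_g d : phi (tens ug d) = proj (- (1 / f) *: (iota d : V)).
  rewrite [ug](_ : _ = 0 *: uf + 1 *: ug); last by rewrite scale1r scale0r add0r.
  by rewrite phiE tofrac1.
have phi_psi z : phi (psi z) = proj (val z).
  have projB v w : proj v - proj w = proj (v - w) by apply/esym; exact: raddfB.
  have -> : phi (psi z) = phi (tens uf (j (g *: (val z : V)))) -
      phi (tens ug (j (f *: (val z : V)))) by exact: raddfB.
  rewrite phi_f phi_g jK// projB sub0r; congr proj.
  by rewrite scalerA mulNr div1r mulVf// scaleN1r opprK.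
apply: (image_isomorphic_subquo (psi := Psi)) => [z|z|q /asboolP[r r0 rq]].
- split=> [pz|].
    have /quo_projP : proj (val z) = proj 0.
      have proj0 : proj 0 = 0 by exact: raddf0.
      have phi0 : phi 0 = 0 by exact: raddf0.
      by rewrite -phi_psi proj0 -phi0; congr (phi _).
    by rewrite subr0.
  move=> zIN; suff [x [y [gx fy xy]]] : exists x y, [/\ iota x = g *: (val z : V),
      iota y = f *: (val z : V) & tens uf x = tens ug y].
    by apply/eqP; rewrite subr_eq0 (jE _ _ gx) (jE _ _ fy) xy.
  move: zIN; apply: (gen_ind (P := fun v : res_scal V => exists x y,
      [/\ iota x = g *: (v : V), iota y = f *: (v : V) & tens uf x = tens ug y])).
  + exists 0, 0; rewrite raddf0.
    split; [exact/esym/(@scaler0 _ V)|exact/esym/(@scaler0 _ V)|].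
    by rewrite -(scale0r 0) !tensZr !scale0r.
  + move=> a v w [x [y [gx fy xy]]] [x' [y' [gx' fy' xy']]].
    exists (a *: x + x'), (a *: y + y').
    rewrite !linearP gx fy gx' fy' !tensDr !tensZr xy xy' !res_scaleE.
    by split=> //; rewrite scalerDr !scalerA mulrC.
  (* For a in I^-1, the scalars a g and a f lie in R and cross the tensor sign,
     which yields (a g f - a f g) (x) d = 0. *)
  move=> _ [a [v [/asboolP aI /mem_N[d <-] ->]]].
  have [p ap] := aI _ mem_gen1; have [q aq] := aI _ mem_gen2.
  exists (q *: d), (p *: d); rewrite !linearZ/= !res_scaleE !scalerA -ap -aq.
  split; [by rewrite mulrC|by rewrite mulrC|].
  rewrite !tensZr -!tensZl; congr tens; apply/val_inj.
  rewrite [LHS]val_scaleK [RHS]val_scaleK.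
  change (tofrac q * f = tofrac p * g :> K).
  by rewrite -ap -aq mulrAC.
- have [r r0 [a ra]] := frac_denom f; have [t t0 [b tb]] := frac_denom g.
  have a0 : a != 0.
    by rewrite -(tofrac_eq0 a) -ra mulf_neq0 ?tofrac_eq0.
  (* With r f = a and t g = b in R, d = a z = r (f z) lies in N, and r t a times
     psi z is (r b f - t a g) (x) d, where r b f = a b = t a g. *)
  apply/asboolP; exists (r * t * a); first by rewrite !mulf_neq0.
  have azN : (tofrac a *: (val z : V) : res_scal V) \in N.
    by rewrite -ra -scalerA; exact: (rpredZ r (fN z)).
  pose d := j (tofrac a *: (val z : V)).
  have jg : (t * a) *: j (g *: (val z : V)) = b *: d.
    apply: iota_inj; rewrite !linearZ/= (jK _ (gN z)) jK//.
    by rewrite !res_scaleE !scalerA -tb tofracM mulrAC.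
  have jf : (r * a) *: j (f *: (val z : V)) = a *: d.
    apply: iota_inj; rewrite !linearZ/= (jK _ (fN z)) jK//.
    by rewrite !res_scaleE !scalerA tofracM mulrAC ra.
  change ((r * t * a) *: psi z = 0); rewrite /psi scalerBr -!tensZr.
  rewrite -[in X in X - _]mulrA -[in X in X - _]scalerA jg.
  rewrite (mulrC r) -[in X in _ - X]mulrA -[in X in _ - X]scalerA jf !scalerA.
  rewrite !tensZr -!tensZl; apply/eqP; rewrite subr_eq0; apply/eqP; congr tens.
  apply/val_inj; rewrite [LHS]val_scaleK [RHS]val_scaleK.
  change (tofrac (r * b) * f = tofrac (t * a) * g :> K).
  by rewrite !tofracM -ra -tb; ring.
have [eta etaE] := evaluation.
have [x [y qxy]] := tensor_two_gen U_coord q.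
have /(congr1 eta) := rq; rewrite linearZ raddf0 => /(torsion_free_res_scal r0).
rewrite qxy raddfD/= !etaE => xy0.
(* The solution of f x + g y = 0 is (x, y) = (g z, - f z) for this z. *)
pose z : V := - f^-1 *: (iota y : V).
have fz : f *: z = iota (- y).
  by rewrite scalerA mulrN divff// scaleN1r raddfN.
have gz : g *: z = iota x.
  apply/(scalerI f_neq0)/esym/eqP.
  rewrite /z !scalerA mulrN -mulrA mulrCA divff// mulr1.
  by rewrite scaleNr -addr_eq0; apply/eqP.
have zP : (z : res_scal V) \in P.
  by apply/mem_P; rewrite fz gz; split; apply/mem_N; eexists.
exists (exist _ (z : res_scal V) zP).
change (psi (exist _ (z : res_scal V) zP) = tens uf x + tens ug y).
rewrite /psi (jE _ _ (esym gz)) (jE _ _ (esym fz)).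
by rewrite -[- y]scaleN1r tensZr scaleN1r opprK.
Qed.
End Embedded.
End TwoGenerated.

(** * Representing the dual by a pairing *)

Section PairingDual.
Variables (R : idomainType) (V : lmodType {fraction R}).
Local Notation K := {fraction R}.
Variable M : submodClosed (res_scal V).
Variable pair : V -> V -> K.
Hypothesis pairl : forall a u v w, pair (a *: u + v) w = a * pair u w + pair v w.
Hypothesis pairr : forall a u v w, pair w (a *: u + v) = a * pair w u + pair w v.
Hypothesis M_nondeg :
  forall v, (forall w : submod M, pair v (val w : V) = 0) -> v = 0.
Hypothesis M_repr : forall h : dualmod (submod M),
  exists v, forall w, pair v (val w : V) = tofrac (val h w : R).

Let pairlZ a u w : pair (a *: u) w = a * pair u w.
Proof.
have pair0 : pair 0 w = 0.
  by have /eqP := pairl 1 0 0 w; rewrite scale1r addr0 mul1r eq_sym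
     -subr_eq0 addrK => /eqP.
by rewrite -[a *: u]addr0 pairl pair0 addr0.
Qed.

Let pairrZ a u w : pair w (a *: u) = a * pair w u.
Proof.
have pair0 : pair w 0 = 0.
  by have /eqP := pairr 1 0 0 w; rewrite scale1r addr0 mul1r eq_sym
     -subr_eq0 addrK => /eqP.
by rewrite -[a *: u]addr0 pairr pair0 addr0.
Qed.

Let pair_eq u v :
  (forall w : submod M, pair u (val w : V) = pair v (val w : V)) -> u = v.
Proof.
move=> uv; apply/eqP; rewrite -subr_eq0; apply/eqP/M_nondeg => w.
by rewrite addrC -scaleN1r pairl uv mulN1r addNr.
Qed.

(** Send a functional to the vector that represents it; nondegeneracy makes this
    vector unique, hence the map linear and injective.  Its image is the inverse
    of M because a vector with all pairings in R defines a functional. *)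
Lemma dual_embedding (N : submodClosed (res_scal V)) :
    (forall v : V, v \in N <-> forall w : V, w \in M -> in_base (pair v w)) ->
  exists iota : {linear dualmod (submod M) -> res_scal V},
    injective iota /\ forall v : V, v \in N <-> exists h, iota h = v.
Proof.
move=> mem_N; have /choice[j jP] := M_repr.
have j_linear : linear (j : dualmod (submod M) -> res_scal V).
  move=> a h k; apply: pair_eq => w; rewrite jP dualE.
  by rewrite [RHS](pairl (tofrac a) (j h) (j k)) !jP tofracD tofracM.
pose jL := GRing.isLinear.Build R (dualmod (submod M)) (res_scal V) *:%R j
  j_linear.
pose iota : {linear dualmod (submod M) -> res_scal V} :=
  HB.pack (j : dualmod (submod M) -> res_scal V) jL.
exists iota; split=> [h k hk|v].
  apply/val_inj/funext => w.
  have /eqP : tofrac (val h w : R) = tofrac (val k w : R).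
    by rewrite -(jP h) -(jP k); congr (pair _ _).
  by rewrite tofrac_eq => /eqP.
split=> [/mem_N vM|[h <-]]; last first.
  by apply/mem_N => w wM; exists (val h (exist _ w wM)); rewrite -jP.
have /choice[h hP] (w : submod M) : exists r : R, pair v (val w : V) = tofrac r.
  exact/vM/valP.
have h_linear : (h : submod M -> R^o) \in @linear_pred R (submod M).
  apply/asboolP => a u w.
  have valE : (val (a *: u + w) : V) = tofrac a *: (val u : V) + (val w : V).
    exact: val_linearK.
  have /eqP : tofrac (h (a *: u + w)) = tofrac (a * h u + h w).
    by rewrite -hP valE pairr !hP tofracD tofracM.
  by rewrite tofrac_eq => /eqP.
exists (exist _ (h : submod M -> R^o) h_linear); apply: pair_eq => w.
by rewrite hP; exact: jP.
Qed.

Variables (f g : K) (I : submodClosed (res_scal K^o)).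

(** Scalars in I move across the pairing, so (I M)^-1 is the colon (M^-1 : I),
    and this can be tested on the generators of I. *)
Lemma mem_inverse_prod (N P : submodClosed (res_scal V)) :
    I =i gen_submod ([set f; g] : set (res_scal K^o)) ->
    (forall v : V, v \in N <-> forall w : V, w \in M -> in_base (pair v w)) ->
    (forall v : V,
       v \in P <-> forall w : V, w \in prodmod I M -> in_base (pair v w)) ->
  forall z : V, z \in P <-> f *: z \in N /\ g *: z \in N.
Proof.
move=> I_gen mem_N mem_P z; split=> [/mem_P zP|[/mem_N fz /mem_N gz]].
  split; apply/mem_N => w wM; rewrite pairlZ -pairrZ; apply: zP;
    apply: mem_prod => //.
    exact: mem_gen1 I_gen.
  exact: mem_gen2 I_gen.
apply/mem_P => w; apply: (gen_ind (P := fun w : res_scal V => in_base (pair z w))).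
- by exists 0; rewrite -[0 in LHS](@scale0r _ V 0) pairrZ mul0r tofrac0.
- move=> a u v uz vz; rewrite [a *: u + v]/(tofrac a *: (u : V) + v : V) pairr.
  exact: in_baseDM.
move=> _ [a [v [/(two_gen_coord I_gen)[r [s ->]] vM ->]]].
have [[p fp] [q gq]] := (fz _ vM, gz _ vM); exists (r * p + s * q).
by rewrite pairrZ tofracD !tofracM -fp -gq !pairlZ; ring.
Qed.

(** The generators f and g play symmetric roles, up to the sign of psi, so the one
    that is nonzero can be put first. *)
Lemma torsion_tensor_dual (N P : submodClosed (res_scal V)) :
    fractional_ideal I ->
    I =i gen_submod ([set f; g] : set (res_scal K^o)) ->
    (forall v : V, v \in N <-> forall w : V, w \in M -> in_base (pair v w)) ->
    (forall v : V,
       v \in P <-> forall w : V, w \in prodmod I M -> in_base (pair v w)) ->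
  isomorphic (torsion (tensor (submod I) (dualmod (submod M))))
    (subquo P (prodmod (colon I) N)).
Proof.
move=> [_ [x xI x0]] I_gen mem_N mem_P.
have [iota [iota_inj iotaN]] := dual_embedding mem_N.
have zP := mem_inverse_prod I_gen mem_N mem_P.
have [f0|f0] := eqVneq f 0; last exact: (torsion_tensor_embedded I_gen f0 iota_inj).
have I_gen' : I =i gen_submod ([set g; f] : set (res_scal K^o)) by rewrite setUC.
have g0 : g != 0.
  have [r [s xE]] := two_gen_coord I_gen xI.
  by apply: contraNneq x0 => g0; rewrite xE f0 g0 !mulr0 addr0.
apply: (torsion_tensor_embedded I_gen' g0 iota_inj) => // z.
by rewrite zP and_comm.
Qed.
End PairingDual.

Section Expansions.
Variables (R : idomainType) (V : lmodType {fraction R}).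
Local Notation K := {fraction R}.
Variable M : submodClosed (res_scal V).

Lemma clear_denominators k (c : 'I_k -> K) (m : 'I_k -> submod M) (w : submod M) :
    (val w : V) = \sum_i c i *: (val (m i) : V) ->
  exists (r : R) (a : 'I_k -> R), [/\ r != 0,
    forall i, tofrac r * c i = tofrac (a i) & r *: w = \sum_i a i *: m i].
Proof.
move=> wE; have [r r0 /choice[a ra]] := fin_denom c; exists r, a; split=> //.
apply/val_inj; transitivity (tofrac r *: (val w : V)); first exact: linearZ.
rewrite wE scaler_sumr raddf_sum; apply: eq_bigr => i _.
by rewrite scalerA ra [RHS]linearZ.
Qed.

(** A functional on M is compatible with linear relations over K, as these
    become relations over R after multiplication by a common denominator. *)
Lemma dual_expansion (h : dualmod (submod M)) k (c : 'I_k -> K)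
    (m : 'I_k -> submod M) (w : submod M) :
    (val w : V) = \sum_i c i *: (val (m i) : V) ->
  tofrac (val h w : R) = \sum_i c i * tofrac (val h (m i) : R).
Proof.
move=> /clear_denominators[r [a [r0 ra rw]]].
have /asboolP h_linear := valP h.
pose hL := GRing.isLinear.Build R (submod M) R^o *:%R (val h) h_linear.
pose H : {linear submod M -> R^o} := HB.pack (val h : submod M -> R^o) hL.
have rH : r * H w = \sum_i a i * H (m i).
  transitivity (H (r *: w)); first by rewrite linearZ.
  by rewrite rw linear_sum; apply: eq_bigr => i _; rewrite linearZ.
apply: (@mulfI _ (tofrac r)); first by rewrite tofrac_eq0.
rewrite -tofracM [val h w]/(H w) rH rmorph_sum mulr_sumr; apply: eq_bigr => i _.
by rewrite mulrA ra -tofracM.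
Qed.
End Expansions.

(** * The dot product and multiplication *)

Section DotProduct.
Variables (R : idomainType) (n : nat).
Local Notation K := {fraction R}.
Variables (M : submodClosed (res_scal 'rV[K]_n)) (b : 'I_n -> submod M).
Hypothesis b_free : lin_indep b.

Let B : 'M[K]_n := \matrix_(i < n) (val (b i) : 'rV[K]_n).

(* Independence over R implies independence over K by clearing denominators, so
   the n vectors of b form a K-basis of K^n. *)
Let B_unit : B \in unitmx.
Proof.
rewrite -row_free_unit; apply: inj_row_free => v vB.
have : (val (0 : submod M) : 'rV[K]_n) = \sum_i v 0 i *: (val (b i) : 'rV[K]_n).
  have -> : (val (0 : submod M) : 'rV[K]_n) = 0 by exact: raddf0.
  by rewrite -[LHS]vB mulmx_sum_row; apply: eq_bigr => i _; rewrite rowK.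
move=> /clear_denominators[r [a [r0 ra]]]; rewrite scaler0 => /esym/b_free a0.
apply/rowP => i; rewrite mxE; apply/eqP; have /eqP := ra i.
by rewrite a0 tofrac0 mulf_eq0 tofrac_eq0 (negPf r0).
Qed.

Let dot_b (v : 'rV[K]_n) i : dot v (val (b i)) = (v *m B^T) 0 i.
Proof. by rewrite mxE; apply: eq_bigr => j _; rewrite !mxE. Qed.

Lemma dot_linearl (a : K) (u v w : 'rV[K]_n) :
  dot (a *: u + v) w = a * dot u w + dot v w.
Proof.
rewrite /dot mulr_sumr -big_split; apply: eq_bigr => i _.
by rewrite !mxE mulrDl mulrA.
Qed.

Lemma dotC (u v : 'rV[K]_n) : dot u v = dot v u.
Proof. by apply: eq_bigr => i _; rewrite mulrC. Qed.

Lemma dot_linearr (a : K) (u v w : 'rV[K]_n) :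
  dot w (a *: u + v) = a * dot w u + dot w v.
Proof. by rewrite dotC dot_linearl !(dotC w). Qed.

Lemma dot_nondeg (v : 'rV[K]_n) :
  (forall w : submod M, dot v (val w) = 0) -> v = 0.
Proof.
move=> v0; have BT : B^T \in unitmx by rewrite unitmx_tr.
rewrite -[v](mulmxK BT) [v *m B^T](_ : _ = 0) ?mul0mx//.
by apply/rowP => i; rewrite -dot_b v0 mxE.
Qed.

(** The vector is the solution v of the n linear equations v . b_i = h b_i; it
    then represents h on all of M by expansion along the basis b. *)
Lemma dot_represents (h : dualmod (submod M)) :
  exists v, forall w, dot v (val w) = tofrac (val h w : R).
Proof.
pose v := (\row_i tofrac (val h (b i) : R)) *m invmx B^T.
exists v => w; pose c := (val w : 'rV[K]_n) *m invmx B.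
have wE : (val w : 'rV[K]_n) = \sum_i c 0 i *: (val (b i) : 'rV[K]_n).
  rewrite -[LHS](mulmxKV B_unit) mulmx_sum_row.
  by apply: eq_bigr => i _; rewrite rowK.
rewrite (dual_expansion h wE) wE.
transitivity (\sum_i c 0 i * dot v (val (b i))).
  rewrite dotC; elim/big_rec2: _ => [|i x y _ <-].
    by rewrite /dot big1// => i _; rewrite mxE mul0r.
  by rewrite dot_linearl (dotC _ v).
apply: eq_bigr => i _; rewrite dot_b /v mulmxKV ?unitmx_tr//.
by congr (_ * _); rewrite mxE.
Qed.
End DotProduct.

Lemma mem_dotinv (R : idomainType) (n : nat)
    (M : submodClosed (res_scal 'rV[{fraction R}]_n)) (v : 'rV[{fraction R}]_n) :
  v \in dotinv M <->
  forall w : 'rV[{fraction R}]_n, w \in M -> in_base (dot v w).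
Proof. by split=> [/asboolP //|vM]; apply/asboolP. Qed.

Lemma mem_colon (R : idomainType) (I : submodClosed (res_scal {fraction R}^o))
    (x : {fraction R}^o) :
  x \in colon I <->
  forall y : {fraction R}^o, y \in I -> in_base ((x : {fraction R}) * y).
Proof. by split=> [/asboolP //|xI]; apply/asboolP. Qed.

Theorem lemma1p9 (R : idomainType) (f g : {fraction R})
    (I : submodClosed (res_scal {fraction R}^o))
    (I_frac : fractional_ideal I)
    (I_gen : I =i gen_submod ([set f; g] : set (res_scal {fraction R}^o))) :
  (forall (n : nat) (M : submodClosed (res_scal 'rV[{fraction R}]_n)),
     fin_gen M -> has_rank (submod M) n ->
     isomorphic (torsion (tensor (submod I) (dualmod (submod M))))
       (subquo (dotinv (prodmod I M)) (prodmod (colon I) (dotinv M))))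
  /\ isomorphic (torsion (tensor (submod I) (dualmod (submod I))))
       (subquo (colon (prodmod I I)) (prodmod (colon I) (colon I))).
Proof.
split=> [n M _ [[b b_free] _]|].
  exact: (@torsion_tensor_dual R _ M (@dot R n) (@dot_linearl R n)
    (@dot_linearr R n) (dot_nondeg b_free) (dot_represents b_free) f g I
    (dotinv M) (dotinv (prodmod I M)) I_frac I_gen (mem_dotinv M)
    (mem_dotinv (prodmod I M))).
have [_ [x xI x0]] := I_frac.
pose mulK (u v : {fraction R}^o) : {fraction R} := (u : {fraction R}) * v.
have mulKl (a : {fraction R}) (u v w : {fraction R}^o) :
    mulK (a *: u + v) w = a * mulK u w + mulK v w.
  by rewrite /mulK mulrDl -mulrA.
have mulKr (a : {fraction R}) (u v w : {fraction R}^o) :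
    mulK w (a *: u + v) = a * mulK w u + mulK w v.
  by rewrite /mulK mulrDr mulrCA.
have nondeg (v : {fraction R}^o) :
    (forall w : submod I, mulK v (val w : {fraction R}^o) = 0) -> v = 0.
  by move=> /(_ (exist _ x xI))/eqP; rewrite mulf_eq0 (negPf x0) orbF => /eqP.
have swap (a w y : {fraction R}) : a / y * w = w / y * a by ring.
have repr (h : dualmod (submod I)) : exists v : {fraction R}^o,
    forall w, mulK v (val w : {fraction R}^o) = tofrac (val h w : R).
  (* A functional on I is multiplication by its slope at any nonzero x in I. *)
  exists (tofrac (val h (exist _ x xI) : R) / x : {fraction R}) => w.
  have wE : (val w : {fraction R}^o) =
      \sum_(i < 1) ((val w : {fraction R}) / x) *: (x : {fraction R}^o).
    by rewrite big_ord1; exact/esym/mulfVK.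
  rewrite (@dual_expansion R _ I h 1 _ (fun=> exist _ x xI) w wE) big_ord1.
  exact: swap.
exact: (@torsion_tensor_dual R _ I mulK mulKl mulKr nondeg repr f g I
  (colon I) (colon (prodmod I I)) I_frac I_gen (mem_colon I)
  (mem_colon (prodmod I I))).
Qed.
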